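(* Let $H$ be a non-stationary channel with kernel $k_H(u,t;u',t')$, decomposed as $$k_H(u,t;u',t')=\sum_{n=1}^{\infty}\sigma_n\,\psi_n(u,t)\,\phi_n(u',t'),$$ with $\iint\psi_n\psi_{n'}^*\,du\,dt=\delta_{nn'}$ and $\iint\phi_n\phi_{n'}^*\,du'\,dt'=\delta_{nn'}$, and let $s(u,t)$ be a data signal, which is expressible in the basis $\{\psi_n\}$ as $s(u,t)=\sum_{n=1}^\infty\langle s,\psi_n\rangle\,\psi_n(u,t)$. Then the precoded signal $x(u,t)$ that ensures interference-free communication at the receiver, i.e. $\|s(u,t)-Hx(u,t)\|^2=0$, is given by $$x(u,t)=\sum_{n=1}^{\infty}x_n\,\phi_n^*(u,t),\qquad\text{where}\quad x_n=\frac{\langle s(u,t),\psi_n(u,t)\rangle}{\sigma_n}.$$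
   Context: The channel $H$ acts on a 2-D (space-time) signal $x$ by $Hx(u,t)=\iint k_H(u,t;u',t')\,x(u',t')\,du'\,dt'$, where $u,u'$ are space (user/antenna) variables and $t,t'$ are time variables. The inner product is $\langle a(u,t),b(u,t)\rangle=\iint a(u,t)b^*(u,t)\,du\,dt$, with norm $\|a\|^2=\langle a,a\rangle$; $^*$ is complex conjugation and $\delta_{nn'}$ the Kronecker delta. The $\sigma_n$ are (random) coefficients with $\mathbb{E}\{\sigma_n\sigma_{n'}\}=\lambda_n\delta_{nn'}$, where $\lambda_n$ is the $n$-th eigenvalue. ''Interference-free communication'' means $\|s-Hx\|^2=0$ (noise is not included in $Hx$).
   Formalization: Assumes that almost surely all σ_n are nonzero and that the series for x converges in mean square to a square-integrable signal (it need not: σ_n=±2^{-n}, ⟨s,ψ_n⟩=2^{-n} give |x_n|=1); all expansions are in the mean-square sense, and uniqueness of x is within the span of the φ_n^*. *)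

(* Defs.v *)
From HB Require Import structures.
From mathcomp Require Import all_boot all_order all_algebra.
From mathcomp Require Import all_classical all_reals all_analysis.
From mathcomp Require Export complex.
Set Implicit Arguments.
Unset Strict Implicit.
Unset Printing Implicit Defensive.
Import Order.TTheory GRing.Theory Num.Theory.
Import numFieldNormedType.Exports.
Local Open Scope classical_set_scope.
Local Open Scope ring_scope.
Local Open Scope complex_scope.

Section ComplexL2.
Context {d : measure_display} {T : measurableType d} {R : realType}.
Variable mu : {measure set T -> \bar R}.
Implicit Types a b f g : T -> R[i].

Definition cmeasurable f : Prop :=
  measurable_fun setT (fun z => complex.Re (f z)) /\
  measurable_fun setT (fun z => complex.Im (f z)).

Definition cintegral f : R[i] :=
  (\int[mu]_z complex.Re (f z))%R +i* (\int[mu]_z complex.Im (f z))%R.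

Definition inner a b : R[i] := cintegral (fun z => a z * conjc (b z)).

(* Extended-real valued, so that a divergent integral is +oo and not a junk
   real number; see [inner_self] for the link with [inner]. *)
Definition normsq a : \bar R :=
  (\int[mu]_z ((Normc.normc (a z)) ^+ 2)%:E)%E.

Definition L2 f : Prop := cmeasurable f /\ (normsq f < +oo)%E.

Definition L2sum (f : nat -> T -> R[i]) g : Prop :=
  L2 g /\
  normsq (fun z => g z - \sum_(n < N) f n z) @[N --> \oo] --> 0%E.

Definition orthonormal_seq (f : nat -> T -> R[i]) : Prop :=
  (forall n, L2 (f n)) /\
  (forall n m, inner (f n) (f m) = (n == m)%:R).

Lemma inner_self a : inner a a = (fine (normsq a))%:C.
Proof.
rewrite /inner /cintegral /normsq /Rintegral; congr (_ +i* _).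
  by congr fine; apply: eq_integral => z _; case: (a z) => x y /=;
     rewrite sqr_sqrtr ?addr_ge0 ?sqr_ge0// mulrN opprK !expr2.
rewrite (_ : (fun _ => _) = (fun=> 0%E)) ?integral0//.
by apply/funext => z; case: (a z) => x y /=; rewrite mulrN (mulrC y) addNr.
Qed.

End ComplexL2.

(* The sigma-finite instance of the library on products is not found by inference
   outside subprobabilities. *)
Lemma sigma_finite_product d1 d2 (T1 : measurableType d1)
    (T2 : measurableType d2) (R : realType)
    (m1 : {sigma_finite_measure set T1 -> \bar R})
    (m2 : {sigma_finite_measure set T2 -> \bar R}) :
  sigma_finite setT (m1 \x m2)%E.
Proof.
have /sigma_finiteP[F [TF ndF Foo]] := sigma_finiteT m1.
have /sigma_finiteP[G [TG ndG Goo]] := sigma_finiteT m2.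
exists (fun n => F n `*` G n).
  rewrite -setXTT TF TG predeqE => -[x y]; split.
    move=> [/= [n _ Fnx] [k _ Gky]]; exists (maxn n k) => //; split.
    - by move: x Fnx; exact/subsetPset/ndF/leq_maxl.
    - by move: y Gky; exact/subsetPset/ndG/leq_maxr.
  by move=> [n _ []/= ? ?]; split; exists n.
move=> k; have [? ?] := Foo k; have [? ?] := Goo k.
split; first exact: measurableX.
by rewrite product_measure1E// lte_mul_pinfty// ge0_fin_numE.
Qed.

Section Channel.
Variable R : realType.

(* [measurableTypeR R] is R with its Borel sigma-algebra. *)
Definition plane := (measurableTypeR R * measurableTypeR R)%type.

Definition signal := plane -> R[i].

(* Arguments are grouped as ((u, t), (u', t')). *)
Definition channel_kernel := (plane * plane)%type -> R[i].

Definition plane_measure : set plane -> \bar R :=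
  (@lebesgue_measure R \x @lebesgue_measure R)%E.

HB.instance Definition _ := Measure.on plane_measure.
HB.instance Definition _ := Measure_isSigmaFinite.Build _ _ _ plane_measure
  (sigma_finite_product _ _).

Definition kernel_measure : set (plane * plane)%type -> \bar R :=
  (plane_measure \x plane_measure)%E.

HB.instance Definition _ := Measure.on kernel_measure.
HB.instance Definition _ := Measure_isSigmaFinite.Build _ _ _ kernel_measure
  (sigma_finite_product _ _).

(* For a square integrable kernel and a square integrable signal the integrand
   is integrable for almost every output point. *)
Definition channel (k : channel_kernel) (x : signal) : signal :=
  fun z => cintegral plane_measure (fun z' => k (z, z') * x z').

End Channel.

Arguments plane_measure R _ : clear implicits.
Arguments kernel_measure R _ : clear implicits.

(* Main.v *)
(* The Hilbert-Schmidt bound makes an integral operator depend continuously, in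
   L2, on its square-integrable kernel. Truncating the expansion of the kernel
   therefore gives, for every signal y = sum_n c_n phi_n^* in L2,
     H y = sum_n sigma_n c_n psi_n   in L2,
   because the pairing of y with phi_n is c_n. For c_n = <s, psi_n> / sigma_n
   this is the expansion of s, and conversely H y = s forces
   sigma_n c_n = <s, psi_n> for all n. *)

Require Import Defs.
From HB Require Import structures.
From mathcomp Require Import all_boot all_order all_algebra.
From mathcomp Require Import all_classical all_reals all_analysis.
From mathcomp Require Import complex.
From mathcomp Require Import measurable_realfun ring lra.
Set Implicit Arguments.
Unset Strict Implicit.
Unset Printing Implicit Defensive.
Import Order.TTheory GRing.Theory Num.Theory.
Import numFieldNormedType.Exports.
Local Open Scope classical_set_scope.
Local Open Scope ring_scope.
Local Open Scope complex_scope.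

(** * Squared modulus of complex numbers *)

Section ComplexModulus.
Variable R : realType.
Implicit Types x y : R[i].

(** Free of square roots, so that bounds become polynomial inequalities and measurability reduces to
    sums and powers. *)
Definition sqn x : R := complex.Re x ^+ 2 + complex.Im x ^+ 2.

Lemma sqn_normc x : Normc.normc x ^+ 2 = sqn x.
Proof. by case: x => a b /=; rewrite sqr_sqrtr// addr_ge0// sqr_ge0. Qed.

Lemma sqn_ge0 x : 0 <= sqn x.
Proof. by rewrite addr_ge0// sqr_ge0. Qed.

Lemma sqn_eq0 x : sqn x = 0 -> x = 0.
Proof.
move/eqP; rewrite paddr_eq0 ?sqr_ge0// !sqrf_eq0.
by case: x => a b /= /andP[/eqP-> /eqP->].
Qed.

Lemma sqnN x : sqn (- x) = sqn x.
Proof. by case: x => a b; rewrite /sqn /= !sqrrN. Qed.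

Lemma sqn_conjc x : sqn (conjc x) = sqn x.
Proof. by case: x => a b; rewrite /sqn /= sqrrN. Qed.

(** Parallelogram law: the two sides differ by [sqn (x - y)]. *)
Lemma sqnD x y : sqn (x + y) <= 2 * (sqn x + sqn y).
Proof.
case: x y => a b [c e]; rewrite /sqn/=.
have := sqr_ge0 (a - c); have := sqr_ge0 (b - e); nra.
Qed.

Lemma ReD x y : complex.Re (x + y) = complex.Re x + complex.Re y.
Proof. by case: x y => a b []. Qed.
Lemma ImD x y : complex.Im (x + y) = complex.Im x + complex.Im y.
Proof. by case: x y => a b []. Qed.
Lemma ReM x y : complex.Re (x * y) =
  complex.Re x * complex.Re y - complex.Im x * complex.Im y.
Proof. by case: x y => a b []. Qed.
Lemma ImM x y : complex.Im (x * y) =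
  complex.Re x * complex.Im y + complex.Im x * complex.Re y.
Proof. by case: x y => a b []. Qed.
Lemma ReN x : complex.Re (- x) = - complex.Re x.
Proof. by case: x. Qed.
Lemma ImN x : complex.Im (- x) = - complex.Im x.
Proof. by case: x. Qed.

Lemma normr_Re_le x : `|complex.Re x| <= Normc.normc x.
Proof.
case: x => a b /=; rewrite -sqrtr_sqr ler_sqrt ?addr_ge0 ?sqr_ge0//.
by rewrite lerDl sqr_ge0.
Qed.

Lemma normr_Im_le x : `|complex.Im x| <= Normc.normc x.
Proof.
case: x => a b /=; rewrite -sqrtr_sqr ler_sqrt ?addr_ge0 ?sqr_ge0//.
by rewrite lerDr sqr_ge0.
Qed.

Lemma normc_ge0 x : 0 <= Normc.normc x.
Proof. by case: x => a b; rewrite /= sqrtr_ge0. Qed.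

End ComplexModulus.

(** * Measurability of complex-valued functions *)

Section CMeasurable.
Context {d : measure_display} {T : measurableType d} {R : realType}.
Implicit Types f g : T -> R[i].

Lemma cmeasurable_cst (c : R[i]) : cmeasurable (fun _ : T => c).
Proof. by split; exact: measurable_cst. Qed.

Lemma cmeasurableD f g : cmeasurable f -> cmeasurable g ->
  cmeasurable (fun z => f z + g z).
Proof.
move=> [fr fi] [gr gi]; split.
  by under eq_fun do rewrite ReD; exact: measurable_funD.
by under eq_fun do rewrite ImD; exact: measurable_funD.
Qed.

Lemma cmeasurableN f : cmeasurable f -> cmeasurable (fun z => - f z).
Proof.
move=> [fr fi]; split.
  by under eq_fun do rewrite ReN; exact: measurableT_comp.
by under eq_fun do rewrite ImN; exact: measurableT_comp.
Qed.

Lemma cmeasurableM f g : cmeasurable f -> cmeasurable g ->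
  cmeasurable (fun z => f z * g z).
Proof.
move=> [fr fi] [gr gi]; split.
  by under eq_fun do rewrite ReM;
    apply: measurable_funB; apply: measurable_funM.
by under eq_fun do rewrite ImM; apply: measurable_funD; apply: measurable_funM.
Qed.

Lemma cmeasurable_conjc f : cmeasurable f -> cmeasurable (fun z => conjc (f z)).
Proof.
move=> [fr fi]; split.
  by apply: eq_measurable_fun fr => z _; case: (f z).
rewrite [X in measurable_fun _ X](_ : _ = fun z => - complex.Im (f z)).
  exact: measurableT_comp.
by apply/funext => z; case: (f z).
Qed.

Lemma cmeasurable_sum (I : Type) (r : seq I) (f : I -> T -> R[i]) :
  (forall i, cmeasurable (f i)) -> cmeasurable (fun z => \sum_(i <- r) f i z).
Proof.
move=> mf; elim: r => [|i r IH].
  by under eq_fun do rewrite big_nil; exact: cmeasurable_cst.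
under eq_fun do rewrite big_cons; exact: cmeasurableD.
Qed.

Lemma measurable_sqn f : cmeasurable f ->
  measurable_fun setT (fun z => (sqn (f z))%:E).
Proof.
move=> [fr fi]; apply/measurable_EFinP.
by apply: measurable_funD; apply: measurable_funX.
Qed.

Lemma measurable_normc f : cmeasurable f ->
  measurable_fun setT (fun z => Normc.normc (f z)).
Proof.
move=> mf.
rewrite [X in measurable_fun _ X](_ : _ = (@Num.sqrt R) \o (fun z => sqn (f z))).
  apply: measurableT_comp; last by apply/measurable_EFinP; exact: measurable_sqn.
  apply: continuous_measurable_fun; exact: sqrt_continuous.
by apply/funext => z /=; rewrite -sqn_normc sqrtr_sqr ger0_norm ?normc_ge0.
Qed.

End CMeasurable.

(** * Integrability and linearity of the complex integral *)

Section CIntegral.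
Context {d : measure_display} {T : measurableType d} {R : realType}.
Variable mu : {measure set T -> \bar R}.
Implicit Types f g h : T -> R[i].

(** Guards the linearity of [cintegral]: [fine] sends infinite integrals to 0, where additivity can
    fail. *)
Definition cintegrable f : Prop :=
  mu.-integrable setT (fun z => (complex.Re (f z))%:E) /\
  mu.-integrable setT (fun z => (complex.Im (f z))%:E).

Lemma cintegrableD f g : cintegrable f -> cintegrable g ->
  cintegrable (fun z => f z + g z).
Proof.
move=> [fr fi] [gr gi]; split.
  under eq_fun do rewrite ReD EFinD; exact: integrableD.
under eq_fun do rewrite ImD EFinD; exact: integrableD.
Qed.

Lemma cintegralD f g : cintegrable f -> cintegrable g ->
  cintegral mu (fun z => f z + g z) = cintegral mu f + cintegral mu g.
Proof.
move=> [fr fi] [gr gi]; rewrite /cintegral.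
under eq_Rintegral do rewrite ReD.
under [X in _ +i* X]eq_Rintegral do rewrite ImD.
by rewrite !RintegralD.
Qed.

Lemma cintegrableZ (c : R[i]) f : cintegrable f ->
  cintegrable (fun z => c * f z).
Proof.
move=> [fr fi]; split.
  under eq_fun do rewrite ReM EFinB !EFinM.
  by apply: integrableB => //; exact: integrableZl.
under eq_fun do rewrite ImM EFinD !EFinM.
by apply: integrableD => //; exact: integrableZl.
Qed.

Lemma cintegralZ (c : R[i]) f : cintegrable f ->
  cintegral mu (fun z => c * f z) = c * cintegral mu f.
Proof.
move=> [fr fi]; rewrite /cintegral.
under eq_Rintegral do rewrite ReM.
under [X in _ +i* X]eq_Rintegral do rewrite ImM.
have Z (a : R) (u : T -> R) : mu.-integrable setT (fun z => (u z)%:E) ->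
    mu.-integrable setT (fun z => (a * u z)%:E).
  by move=> iu; under eq_fun do rewrite EFinM; exact: integrableZl.
rewrite RintegralB//; [|exact: Z..].
rewrite RintegralD//; [|exact: Z..].
by rewrite !RintegralZl//; case: c.
Qed.

Lemma cintegral0 : cintegral mu (fun _ => 0) = 0.
Proof. by rewrite /cintegral /Rintegral /= integral0. Qed.

Lemma cintegrable0 : cintegrable (fun _ => 0).
Proof. by split; exact: integrable0. Qed.

Lemma cintegralB f g : cintegrable f -> cintegrable g ->
  cintegral mu (fun z => f z - g z) = cintegral mu f - cintegral mu g.
Proof.
move=> fi gi; rewrite -[X in _ = _ + X]mulN1r -cintegralZ// -cintegralD//.
  by under eq_fun do rewrite -mulN1r.
exact: cintegrableZ.
Qed.

Lemma cintegral_sum (I : Type) (r : seq I) (f : I -> T -> R[i]) :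
  (forall i, cintegrable (f i)) ->
  cintegrable (fun z => \sum_(i <- r) f i z) /\
  cintegral mu (fun z => \sum_(i <- r) f i z) =
  \sum_(i <- r) cintegral mu (f i).
Proof.
move=> fi; elim: r => [|i r [IH1 IH2]].
  under eq_fun do rewrite big_nil; rewrite big_nil cintegral0; split=> //.
  exact: cintegrable0.
under eq_fun do rewrite big_cons; split; first exact: cintegrableD.
by rewrite big_cons cintegralD// IH2.
Qed.

End CIntegral.

(** Used to show that a fixed nonnegative quantity vanishes, by bounding it with truncation
    errors. *)
Lemma cvge_to0_le (R : realType) (u : nat -> \bar R) (x : \bar R) :
  u N @[N --> \oo] --> 0%E -> (\forall N \near \oo, (x <= u N)%E) ->
  (x <= 0)%E.
Proof.
move=> u0 xu; rewrite -(cvg_lim _ u0)//; apply: lime_ge => //.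
by apply/cvg_ex; exists 0%E.
Qed.

(** * Square-integrable functions, Cauchy-Schwarz and L2 series *)

Section L2Theory.
Context {d : measure_display} {T : measurableType d} {R : realType}.
Variable mu : {measure set T -> \bar R}.
Implicit Types f g h : T -> R[i].

Lemma normsqE f : normsq mu f = (\int[mu]_z (sqn (f z))%:E)%E.
Proof. by apply: eq_integral => z _; rewrite sqn_normc. Qed.

Lemma normsq_ge0 f : (0 <= normsq mu f)%E.
Proof. by rewrite normsqE integral_ge0// => z _; rewrite lee_fin sqn_ge0. Qed.

(** Integrating [sqnD] gives this substitute for the triangle inequality; it holds for infinite
    norms too, and the constant does not affect limits at 0. *)
Lemma normsqB f g : cmeasurable f -> cmeasurable g ->
  (normsq mu (fun z => (f z - g z)%R) <= 2%:E * (normsq mu f + normsq mu g))%E.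
Proof.
move=> mf mg; have pos (h : T -> R[i]) z : (0 <= (sqn (h z))%:E)%E.
  by rewrite lee_fin sqn_ge0.
have mfg := measurable_sqn (cmeasurableD mf (cmeasurableN mg)).
rewrite !normsqE -ge0_integralD//; [|exact: measurable_sqn..].
rewrite -ge0_integralZl//; last 2 first.
- by apply: emeasurable_funD; exact: measurable_sqn.
- by move=> z _; rewrite adde_ge0 ?pos.
apply: ge0_le_integral => //.
  by move=> z _; rewrite lee_fin sqn_ge0.
  by apply: measurable_funeM; apply: emeasurable_funD; exact: measurable_sqn.
move=> z _; rewrite -EFinD -EFinM lee_fin.
by apply: le_trans (sqnD _ _) _; rewrite sqnN.
Qed.

Lemma normsq_conjc f : normsq mu (fun z => conjc (f z)) = normsq mu f.
Proof. by rewrite !normsqE; apply: eq_integral => z _; rewrite sqn_conjc. Qed.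

Lemma L2_conjc f : L2 mu f -> L2 mu (fun z => conjc (f z)).
Proof.
by move=> [mf fy]; split; [exact: cmeasurable_conjc|rewrite normsq_conjc].
Qed.

Lemma cmeasurable_integrable f :
  cmeasurable f -> mu.-integrable setT (fun z => (Normc.normc (f z))%:E) ->
  cintegrable mu f.
Proof.
move=> [fr fi] intf; split; apply: le_integrable intf => //.
- exact/measurable_EFinP.
- move=> z _; rewrite !abse_EFin lee_fin (le_trans (normr_Re_le _))//.
  exact: ler_norm.
- exact/measurable_EFinP.
- move=> z _; rewrite !abse_EFin lee_fin (le_trans (normr_Im_le _))//.
  exact: ler_norm.
Qed.

(** By the arithmetic-geometric mean inequality the modulus of the product is dominated by the
    integrable function [sqn (f z) + sqn (g z)]. *)
Lemma L2_cintegrableM f g : L2 mu f -> L2 mu g ->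
  cintegrable mu (fun z => f z * g z).
Proof.
move=> [mf fy] [mg gy]; have mfg := cmeasurableM mf mg.
have int_sqn h : cmeasurable h -> (normsq mu h < +oo)%E ->
    mu.-integrable setT (fun z => (sqn (h z))%:E).
  move=> mh hy; apply/integrableP; split; first exact: measurable_sqn.
  under eq_integral do rewrite gee0_abs ?lee_fin ?sqn_ge0//.
  by rewrite -normsqE.
apply: cmeasurable_integrable => //.
apply: le_integrable (integrableD measurableT (int_sqn _ mf fy) (int_sqn _ mg gy)).
- by [].
- by apply/measurable_EFinP; exact: measurable_normc.
move=> z _; rewrite /= lee_fin !ger0_norm ?normc_ge0
  ?(addr_ge0 (sqn_ge0 _) (sqn_ge0 _))//.
rewrite Normc.normcM -!sqn_normc.
have := normc_ge0 (f z); have := normc_ge0 (g z).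
have := sqr_ge0 (Normc.normc (f z) - Normc.normc (g z)); nra.
Qed.

(** Hölder with both exponents equal to 2, squared so that no root appears in the bound. *)
Lemma integral_normcM_le f g : cmeasurable f -> cmeasurable g ->
  ((\int[mu]_z (Normc.normc (f z) * Normc.normc (g z))%:E) ^+ 2
    <= normsq mu f * normsq mu g)%E.
Proof.
move=> mf mg.
have sqr_poweR (x : \bar R) : (0 <= x -> x ^+ 2 = x `^ 2)%E.
  case: x => [r| |]//; first by rewrite lee_fin => r0; rewrite poweR_EFin powR_mulrn.
  by rewrite poweRyr ?pnatr_eq0// expe2 mulyy.
have L2norm h :
    (normsq mu h = 'N[mu]_2%:E[EFin \o (fun z => Normc.normc (h z))] ^+ 2)%E.
  rewrite sqr_poweR ?Lnorm_ge0// poweR_Lnorm ?pnatr_eq0//.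
  apply: eq_integral => z _ /=.
  by rewrite ger0_norm ?normc_ge0// powR_mulrn ?normc_ge0.
have N0 (h : T -> R) : (0 <= 'N[mu]_2%:E[EFin \o h])%E by exact: Lnorm_ge0.
rewrite !L2norm [leRHS](_ : _ = (('N[mu]_2%:E[EFin \o (fun z => Normc.normc (f z))] *
  'N[mu]_2%:E[EFin \o (fun z => Normc.normc (g z))]) ^+ 2)%E); last first.
  by rewrite !expe2 muleACA.
rewrite lee_sqr ?mule_ge0//; last first.
  by apply: integral_ge0 => z _; rewrite lee_fin mulr_ge0 ?normc_ge0.
have := hoelder mu (measurable_normc mf) (measurable_normc mg)
  (ltr0n _ 2) (ltr0n _ 2).
rewrite Lnorm1 => /(_ _) hold; apply: le_trans (hold _); last by lra.
apply: ge0_le_integral => //.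
- by move=> z _; rewrite lee_fin mulr_ge0 ?normc_ge0.
- by apply/measurable_EFinP; apply: measurable_funM; exact: measurable_normc.
- by apply: measurableT_comp => //; apply/measurable_EFinP; apply: measurable_funM;
     exact: measurable_normc.
- by move=> z _; exact: lee_abs.
Qed.

(* The factor 2, harmless for continuity, comes from bounding the real and the
   imaginary part separately. *)
Lemma cauchy_schwarz f g : cmeasurable f -> cmeasurable g ->
  ((sqn (cintegral mu (fun z => (f z * g z)%R)))%:E
    <= 2%:E * (normsq mu f * normsq mu g))%E.
Proof.
move=> mf mg; have [mr mi] := cmeasurableM mf mg.
set A := (\int[mu]_z (Normc.normc (f z) * Normc.normc (g z))%:E)%E.
have bound (u : T -> R) : measurable_fun setT u ->
    (forall z, `|u z| <= Normc.normc (f z) * Normc.normc (g z)) ->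
    (((\int[mu]_z u z)%R ^+ 2)%:E <= A ^+ 2)%E.
  move=> mu_ uA; have A0 : (0 <= A)%E.
    by apply: integral_ge0 => z _; rewrite lee_fin mulr_ge0 ?normc_ge0.
  have : (`|\int[mu]_z (u z)%:E| <= A)%E.
    apply: le_trans (le_abse_integral mu measurableT _) _.
      exact/measurable_EFinP.
    apply: ge0_le_integral => //.
    - by apply: measurableT_comp => //; exact/measurable_EFinP.
    - by apply/measurable_EFinP; apply: measurable_funM; exact: measurable_normc.
    - by move=> z _; rewrite abse_EFin lee_fin.
  (* If the integral is infinite, [fine] makes it 0 and the bound is trivial; only the finite case
     uses [rA]. *)
  rewrite /Rintegral; case: (integral _ _ _) => [r| |] /= rA.
  - by rewrite -real_normK ?num_real// EFin_expe lee_sqr.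
  - by rewrite expr0n /= sqre_ge0.
  - by rewrite expr0n /= sqre_ge0.
apply: (@le_trans _ _ (A ^+ 2 + A ^+ 2)%E).
  rewrite /sqn EFinD; apply: leeD; apply: bound => // z.
    by rewrite -Normc.normcM; exact: normr_Re_le.
  by rewrite -Normc.normcM; exact: normr_Im_le.
rewrite -mule2n -mule_natl lee_wpmul2l ?lee_fin//.
exact: integral_normcM_le.
Qed.

(** Both functions are approximated by the same partial sums, and [f - g] is the difference of the
    two errors. *)
Lemma L2sum_unique (u : nat -> T -> R[i]) f g :
  (forall n, cmeasurable (u n)) -> L2sum mu u f -> L2sum mu u g ->
  normsq mu (fun z => f z - g z) = 0%E.
Proof.
move=> mu_ [[mf _] uf] [[mg _] ug].
pose S N z := \sum_(n < N) u n z.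
have mS N : cmeasurable (S N) by exact: cmeasurable_sum.
have le0 N : (normsq mu (fun z => (f z - g z)%R) <=
   2%:E * (normsq mu (fun z => (f z - S N z)%R) +
           normsq mu (fun z => (g z - S N z)%R)))%E.
  rewrite [X in normsq mu X](_ : _ = (fun z =>
    (f z - S N z) - (g z - S N z))); last first.
    by apply/funext => z; rewrite opprB addrA subrK.
  by apply: normsqB; exact: cmeasurableD (cmeasurableN _).
apply/eqP; rewrite eq_le normsq_ge0 andbT.
have cvg0 : (2%:E * (normsq mu (fun z => (f z - S N z)%R) +
    normsq mu (fun z => (g z - S N z)%R)))%E @[N --> \oo] --> 0%E.
  rewrite -(mule0 2%:E); apply: cvgeZl => //; rewrite -(adde0 0%E).
  exact: cvgeD.
apply: cvge_to0_le cvg0 _; exact: nearW.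
Qed.

(* A square-integrable limit pairs with [h] as the limit of the pairings, by
   Cauchy-Schwarz, and here those pairings are eventually constant. *)
Lemma L2sum_coef (c : nat -> R[i]) (e : nat -> T -> R[i]) f h m :
  (forall n, L2 mu (e n)) -> L2 mu h ->
  (forall n, cintegral mu (fun z => e n z * h z) = (n == m)%:R) ->
  L2sum mu (fun n z => c n * e n z) f ->
  cintegral mu (fun z => f z * h z) = c m.
Proof.
move=> L2e L2h eh [L2f cvgf].
pose S N z := \sum_(n < N) c n * e n z.
have mS N : cmeasurable (S N).
  by apply: cmeasurable_sum => n; exact: cmeasurableM (cmeasurable_cst _) (L2e n).1.
have S_h N : cintegrable mu (fun z => S N z * h z) /\
    cintegral mu (fun z => S N z * h z) = \sum_(n < N) c n * (n == m :> nat)%:R.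
  have ceh (n : 'I_N) : cintegrable mu (fun z => c n * (e n z * h z)).
    by apply: cintegrableZ; exact: L2_cintegrableM.
  have [iS SE] := cintegral_sum (index_enum 'I_N) ceh.
  rewrite (_ : (fun z => S N z * h z) =
    fun z => \sum_(n < N) c n * (e n z * h z)); last first.
    by apply/funext => z; rewrite mulr_suml; apply: eq_bigr => n _; rewrite mulrA.
  split => //; rewrite SE; apply: eq_bigr => n _.
  by rewrite cintegralZ ?eh//; exact: L2_cintegrableM.
(* Once [m < N] the partial sum contains the term of index [m], so its pairing with [h] is exactly
   [c m] and only the truncation error remains. *)
have le0 N : (m < N)%N ->
    ((sqn (cintegral mu (fun z => (f z * h z)%R) - c m)%R)%:E <=
    2%:E * (normsq mu (fun z => (f z - S N z)%R) * normsq mu h))%E.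
  move=> mN; have -> : c m = cintegral mu (fun z => S N z * h z).
    rewrite (S_h N).2 (bigD1 (Ordinal mN))//= eqxx mulr1 big1 ?addr0// => n nm.
    by rewrite (_ : _ == _ = false) ?mulr0//; apply: contraNF nm.
  rewrite -cintegralB; [|exact: L2_cintegrableM|exact: (S_h N).1].
  under eq_fun do rewrite -mulrBl.
  by apply: cauchy_schwarz => //; [exact: cmeasurableD L2f.1 (cmeasurableN (mS N))|
    exact: L2h.1].
(* Finiteness of [normsq mu h] lets the product follow its first factor to 0. *)
have cvg0 : (2%:E * (normsq mu (fun z => (f z - S N z)%R) * normsq mu h))%E
    @[N --> \oo] --> 0%E.
  rewrite -(mule0 2%:E); apply: cvgeZl => //; rewrite -(mul0e (normsq mu h)).
  by apply: cvgeZr cvgf; rewrite ge0_fin_numE ?normsq_ge0//; exact: L2h.2.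
apply/eqP; rewrite -subr_eq0; apply/eqP/sqn_eq0/eqP.
rewrite eq_le sqn_ge0 andbT -lee_fin; apply: cvge_to0_le cvg0 _.
by near=> N; apply: le0; near: N; exact: nbhs_infty_gt.
Unshelve. all: by end_near. Qed.

Lemma normsq_eq0 f : cmeasurable f -> normsq mu f = 0%E ->
  {ae mu, forall z, f z = 0}.
Proof.
move=> mf f0.
have /(ae_eq_integral_abs mu measurableT (measurable_sqn mf)) :
    (\int[mu]_z `|(sqn (f z))%:E| = 0)%E.
  by under eq_integral do rewrite gee0_abs ?lee_fin ?sqn_ge0//; rewrite -normsqE.
by apply: filterS => z /(_ I) [/sqn_eq0].
Qed.

Lemma eq_normsq_ae f g : cmeasurable f -> cmeasurable g ->
  {ae mu, forall z, f z = g z} -> normsq mu f = normsq mu g.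
Proof.
move=> mf mg fg; rewrite !normsqE; apply: ge0_ae_eq_integral => //.
- exact: measurable_sqn.
- exact: measurable_sqn.
- by move=> z _; rewrite lee_fin sqn_ge0.
- by move=> z _; rewrite lee_fin sqn_ge0.
by apply: filterS fg => z ->.
Qed.

End L2Theory.

(** * Hilbert-Schmidt integral operators *)

Section IntegralOperator.
Context {d1 d2 : measure_display} {T1 : measurableType d1}
  {T2 : measurableType d2} {R : realType}.
Variables (m1 : {sigma_finite_measure set T1 -> \bar R})
  (m2 : {sigma_finite_measure set T2 -> \bar R}).
Implicit Types (k : T1 * T2 -> R[i]) (x : T2 -> R[i]).

Local Notation m12 := (m1 \x m2)%E.

(** Unfolds to [channel] when both spaces are [plane] with [plane_measure]; two separate spaces keep
    output and input variables apart. *)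
Definition integral_op k x : T1 -> R[i] :=
  fun z => cintegral m2 (fun z' => k (z, z') * x z').

(** Since [u] is not assumed integrable, Tonelli is applied to its positive and negative parts, and
    [fine] of the measurable difference is taken. *)
Lemma measurable_integral_section (u : T1 * T2 -> R) : measurable_fun setT u ->
  measurable_fun setT (fun z => (\int[m2]_z' u (z, z'))%R).
Proof.
move=> mu; have mU : measurable_fun setT (EFin \o u) by exact/measurable_EFinP.
apply: (measurableT_comp (fine_measurable measurableT)).
rewrite [X in measurable_fun _ X](_ : _ =
  (fubini_F m2 ((EFin \o u)^\+) \- fubini_F m2 ((EFin \o u)^\-))%E).
  by apply: emeasurable_funB; apply: measurable_fun_fubini_tonelli_F => //;
    [exact: measurable_funepos|exact: measurable_funeneg].
apply/funext => z; rewrite integralE /fubini_F /=.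
by congr (_ - _)%E; apply: eq_integral => z' _; rewrite ?funeposE ?funenegE.
Qed.

Lemma cmeasurable_fst (f : T1 -> R[i]) :
  cmeasurable f -> cmeasurable (fun p : T1 * T2 => f p.1).
Proof.
by move=> [fr fi]; split;
  [exact: (measurableT_comp fr)|exact: (measurableT_comp fi)].
Qed.

Lemma cmeasurable_snd x :
  cmeasurable x -> cmeasurable (fun p : T1 * T2 => x p.2).
Proof.
by move=> [fr fi]; split;
  [exact: (measurableT_comp fr)|exact: (measurableT_comp fi)].
Qed.

Lemma cmeasurable_section k z :
  cmeasurable k -> cmeasurable (fun z' => k (z, z')).
Proof.
by move=> [fr fi]; split;
  [exact: (measurableT_comp fr)|exact: (measurableT_comp fi)].
Qed.

Lemma cmeasurable_integral_op k x :
  cmeasurable k -> cmeasurable x -> cmeasurable (integral_op k x).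
Proof.
move=> mk mx; have [mr mi] := cmeasurableM mk (cmeasurable_snd mx).
by split; [exact: measurable_integral_section mr|
  exact: measurable_integral_section mi].
Qed.

Lemma normsq_product k : cmeasurable k ->
  normsq m12 k = (\int[m1]_z normsq m2 (fun z' => k (z, z')))%E.
Proof.
move=> mk; rewrite normsqE fubini_tonelli1//.
- by apply: eq_integral => z _; rewrite normsqE.
- exact: measurable_sqn.
- by move=> z; rewrite lee_fin sqn_ge0.
Qed.

Lemma measurable_normsq_section k : cmeasurable k ->
  measurable_fun setT (fun z => normsq m2 (fun z' => k (z, z'))).
Proof.
move=> mk; under eq_fun do rewrite normsqE.
apply: (measurable_fun_fubini_tonelli_F (fun p => (sqn (k p))%:E)).
- exact: measurable_sqn.
- by move=> z; rewrite lee_fin sqn_ge0.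
Qed.

(** Hilbert-Schmidt bound: Cauchy-Schwarz on each section of the kernel, integrated over the output
    variable by Tonelli. The factor 2 is inherited from [cauchy_schwarz]. *)
Lemma normsq_integral_op_le k x : cmeasurable k -> cmeasurable x ->
  (normsq m1 (integral_op k x) <= 2%:E * (normsq m12 k * normsq m2 x))%E.
Proof.
move=> mk mx; rewrite normsqE normsq_product//.
rewrite -ge0_integralZr ?normsq_ge0//; last 2 first.
- exact: measurable_normsq_section.
- by move=> z _; exact: normsq_ge0.
rewrite -ge0_integralZl//; last 2 first.
- by apply: emeasurable_funM => //; exact: measurable_normsq_section.
- by move=> z _; rewrite mule_ge0 ?normsq_ge0.
apply: ge0_le_integral => //.
- by move=> z _; rewrite lee_fin sqn_ge0.
- by apply: measurable_sqn; exact: cmeasurable_integral_op.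
- apply: measurable_funeM; apply: emeasurable_funM => //.
  exact: measurable_normsq_section.
by move=> z _; apply: cauchy_schwarz => //; exact: cmeasurable_section.
Qed.

Lemma L2_integral_op k x : L2 m12 k -> L2 m2 x -> L2 m1 (integral_op k x).
Proof.
move=> [mk ky] [mx xy]; split; first exact: cmeasurable_integral_op.
apply: le_lt_trans (normsq_integral_op_le mk mx) _.
by rewrite lte_mul_pinfty// lte_mul_pinfty ?normsq_ge0// ge0_fin_numE ?normsq_ge0.
Qed.

(** Fubini for [sqn (k p)]. Off this null set the integrand defining the output is integrable, so
    the output is additive in the kernel there. *)
Lemma L2_section_ae k : L2 m12 k ->
  {ae m1, forall z, L2 m2 (fun z' => k (z, z'))}.
Proof.
move=> [mk ky].
have : m12.-integrable setT (fun p => (sqn (k p))%:E).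
  apply/integrableP; split; first exact: measurable_sqn.
  under eq_integral do rewrite gee0_abs ?lee_fin ?sqn_ge0//.
  by rewrite -normsqE.
move=> /ae_integrable1; apply: filterS => z /integrableP[_ zy].
split; first exact: cmeasurable_section.
rewrite normsqE; apply: le_lt_trans zy.
by under [leRHS]eq_integral do rewrite gee0_abs ?lee_fin ?sqn_ge0//.
Qed.

(* Truncating the kernel truncates the output, and the Hilbert-Schmidt bound
   [normsq_integral_op_le] turns convergence of the kernels into convergence
   of the outputs. *)
Lemma L2sum_integral_op k x (sigma c : nat -> R[i])
    (psi : nat -> T1 -> R[i]) (phi : nat -> T2 -> R[i]) :
  (forall n, L2 m1 (psi n)) -> orthonormal_seq m2 phi ->
  L2sum m12 (fun n p => sigma n * psi n p.1 * phi n p.2) k ->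
  L2sum m2 (fun n z => c n * conjc (phi n z)) x ->
  L2sum m1 (fun n z => sigma n * c n * psi n z) (integral_op k x).
Proof.
move=> L2psi [L2phi phi_on] [L2k cvgk] L2sx; have L2x := L2sx.1.
split; first exact: L2_integral_op.
(* The kernel acts on [x] by a bilinear pairing, without conjugation, so the family dual to [phi] is
   its conjugate; hence the [conjc] in the expansion of [x]. *)
have coef n : cintegral m2 (fun z => phi n z * x z) = c n.
  under eq_fun do rewrite mulrC.
  apply: L2sum_coef L2sx => // [m|m]; first exact: L2_conjc.
  rewrite eq_sym -phi_on; congr cintegral.
  by apply/funext => z; rewrite mulrC.
pose K N (p : T1 * T2) := \sum_(n < N) sigma n * psi n p.1 * phi n p.2.
have mK N : cmeasurable (K N).
  apply: cmeasurable_sum => n; apply: cmeasurableM;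
    last exact: cmeasurable_snd (L2phi n).1.
  by apply: cmeasurableM; [exact: cmeasurable_cst|
    exact: cmeasurable_fst (L2psi n).1].
have mkK N : cmeasurable (fun p => k p - K N p).
  exact: cmeasurableD L2k.1 (cmeasurableN (mK N)).
(* The truncated kernel has finite rank, so its output is computed term by term at every point. *)
have opK N z : cintegrable m2 (fun z' => K N (z, z') * x z') /\
    integral_op (K N) x z = \sum_(n < N) sigma n * c n * psi n z.
  have ig (n : 'I_N) :
      cintegrable m2 (fun z' => sigma n * psi n z * (phi n z' * x z')).
    by apply: cintegrableZ; exact: L2_cintegrableM.
  have [iS SE] := cintegral_sum (index_enum 'I_N) ig.
  rewrite /integral_op (_ : (fun z' => K N (z, z') * x z') =
    fun z' => \sum_(n < N) sigma n * psi n z * (phi n z' * x z')); last first.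
    by apply/funext => z'; rewrite mulr_suml; apply: eq_bigr => n _; rewrite !mulrA.
  split => //; rewrite SE; apply: eq_bigr => n _.
  rewrite cintegralZ; last exact: L2_cintegrableM.
  by rewrite coef mulrAC.
(* The two functions agree only almost everywhere: splitting the integral of the difference requires
   the section of [k] to be in L2. *)
have diff N : normsq m1 (fun z => integral_op k x z -
      \sum_(n < N) sigma n * c n * psi n z) =
    normsq m1 (integral_op (fun p => k p - K N p) x).
  apply: eq_normsq_ae.
  - apply: cmeasurableD; first exact: cmeasurable_integral_op L2k.1 L2x.1.
    apply: cmeasurableN; apply: cmeasurable_sum => n.
    exact: cmeasurableM (cmeasurable_cst _) (L2psi n).1.
  - exact: cmeasurable_integral_op (mkK N) L2x.1.
  apply: filterS (L2_section_ae L2k) => z L2kz.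
  rewrite -(opK N z).2 /integral_op -cintegralB; last 2 first.
  - exact: L2_cintegrableM.
  - exact: (opK N z).1.
  by congr cintegral; apply/funext => z'; rewrite mulrBl.
under eq_fun do rewrite diff.
apply: (@squeeze_cvge _ _ _ _ (cst 0%E) _
  (fun N => 2%:E * (normsq m12 (fun p => (k p - K N p)%R) * normsq m2 x))%E).
- apply: nearW => N; rewrite normsq_ge0/=.
  by apply: normsq_integral_op_le => //; exact: L2x.1.
- exact: cvg_cst.
rewrite -(mule0 2%:E); apply: cvgeZl => //; rewrite -(mul0e (normsq m2 x)).
by apply: cvgeZr cvgk; rewrite ge0_fin_numE ?normsq_ge0//; exact: L2x.2.
Qed.

End IntegralOperator.

(** Dividing by [sigma n w] can destroy square summability, so convergence of the series is part of
    what is assumed of [x]. The exceptional set of [w] is fixed before [x] and [y] are chosen.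
    Uniqueness is stated among expansions in the conjugates of [phi], because a component orthogonal
    to all of them would be annihilated by the channel. *)
Theorem theorem2 (R : realType)
  (d : measure_display) (Omega : measurableType d) (P : probability Omega R)
  (sigma : nat -> Omega -> R[i]) (lambda : nat -> R[i])
  (sigma_L2 : forall n, L2 P (sigma n))
  (sigma_cov : forall n m,
     cintegral P (fun w => sigma n w * sigma m w) = lambda n * (n == m)%:R)
  (sigma_neq0 : {ae P, forall w, forall n, sigma n w != 0})
  (kH : Omega -> channel_kernel R) (psi phi : nat -> signal R)
  (psi_on : orthonormal_seq (plane_measure R) psi)
  (phi_on : orthonormal_seq (plane_measure R) phi)
  (kH_dec : {ae P, forall w,
     L2sum (kernel_measure R)
       (fun n p => sigma n w * psi n p.1 * phi n p.2) (kH w)})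
  (s : signal R)
  (s_dec : L2sum (plane_measure R)
     (fun n z => inner (plane_measure R) s (psi n) * psi n z) s) :
  {ae P, forall w, forall x : signal R,
     L2sum (plane_measure R)
       (fun n z => inner (plane_measure R) s (psi n) / sigma n w
                   * conjc (phi n z)) x ->
     [/\ L2 (plane_measure R) (channel (kH w) x),
         normsq (plane_measure R) (fun z => s z - channel (kH w) x z) = 0%E &
         forall (c : nat -> R[i]) (y : signal R),
           L2sum (plane_measure R) (fun n z => c n * conjc (phi n z)) y ->
           normsq (plane_measure R) (fun z => s z - channel (kH w) y z) = 0%E ->
           {ae plane_measure R, forall z, y z = x z}]}.
Proof.
(* Outside the union of two null sets the realization [w] is fixed, and the rest of the argument is
   deterministic. *)
apply: filterS2 sigma_neq0 kH_dec => w sw0 kw x xsum.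
have L2psi := psi_on.1.
pose c n := inner (plane_measure R) s (psi n).
have mpsi (a : nat -> R[i]) n : cmeasurable (fun z => a n * psi n z).
  exact: cmeasurableM (cmeasurable_cst _) (L2psi n).1.
have out (b : nat -> R[i]) (y : signal R) :
    L2sum (plane_measure R) (fun n z => b n * conjc (phi n z)) y ->
    L2sum (plane_measure R) (fun n z => sigma n w * b n * psi n z)
      (channel (kH w) y).
  exact: (L2sum_integral_op L2psi phi_on kw).
(* The nonzero gains cancel the divisions, so the output and [s] are L2 sums of one and the same
   series. *)
have Hx : L2sum (plane_measure R) (fun n z => c n * psi n z) (channel (kH w) x).
  have := out _ _ xsum.
  by under eq_fun do under eq_fun do rewrite [sigma _ _ * _]mulrC divfK//.
split; first exact: Hx.1.
  exact: L2sum_unique (mpsi c) s_dec Hx.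
move=> b y ysum sHy0; have Hy := out _ _ ysum.
have coef (a : nat -> R[i]) f m :
    L2sum (plane_measure R) (fun n z => a n * psi n z) f ->
    inner (plane_measure R) f (psi m) = a m.
  apply: L2sum_coef => //; [exact: L2_conjc|by move=> n; rewrite -psi_on.2].
(* After multiplication by the nonzero [sigma n w], the claim equates the coefficients of the output
   and of [s] along [psi n]. They agree by Cauchy-Schwarz, as [s] minus the output has norm zero. *)
have bE n : b n = c n / sigma n w.
  apply: (mulfI (sw0 n)); rewrite [RHS]mulrC divfK// -(coef _ _ n Hy) /c.
  apply/esym/eqP; rewrite -subr_eq0; apply/eqP/sqn_eq0/eqP.
  have L2psin := L2_conjc (L2psi n).
  rewrite /inner -cintegralB; [|exact: L2_cintegrableM s_dec.1 L2psin
                               |exact: L2_cintegrableM Hy.1 L2psin].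
  under eq_fun do rewrite -mulrBl.
  rewrite eq_le sqn_ge0 andbT -lee_fin.
  have /= := cauchy_schwarz (plane_measure R)
    (cmeasurableD s_dec.1.1 (cmeasurableN Hy.1.1)) L2psin.1.
  by rewrite sHy0 mul0e mule0.
have {}ysum : L2sum (plane_measure R)
    (fun n z => c n / sigma n w * conjc (phi n z)) y.
  by under eq_fun do rewrite -bE.
(* With equal coefficients, [y] and [x] are L2 sums of the same series, hence equal almost
   everywhere. *)
have yx0 := L2sum_unique (fun n =>
  cmeasurableM (cmeasurable_cst _) (cmeasurable_conjc (phi_on.1 n).1)) ysum xsum.
have := normsq_eq0 (cmeasurableD ysum.1.1 (cmeasurableN xsum.1.1)) yx0.
by apply: filterS => z /eqP; rewrite subr_eq0 => /eqP.
Qed.
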